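(* There is a computable graph $\mathcal{G}$ such that for every $\Delta_2$ cohesive set $C \subseteq \mathbb{N}$, the cohesive power $\prod_C \mathcal{G}$ has degree $0''$.
   Context: $0''$ denotes the double Turing jump of the empty set, and $\Delta_2$ refers to the arithmetical hierarchy. Graphs are simple graphs, viewed as structures in the language with one binary relation symbol (the edge relation, symmetric and irreflexive). Presentations and degrees: A presentation (or copy) of a countable structure $\mathcal{M}$ is an isomorphic copy of $\mathcal{M}$ whose domain is a non-empty subset of $\mathbb{N}$. A structure with domain contained in $\mathbb{N}$ is identified with the subset of $\mathbb{N}$ encoding (as an effective join) its domain and its relations; computability-theoretic terms (computable, computes) applied to such a structure refer to this set. A countable structure $\mathcal{M}$ has degree $X$ (more precisely, degree equal to the Turing degree of $X$), for $X \subseteq \mathbb{N}$, if $\mathcal{M}$ has an $X$-computable presentation and every presentation of $\mathcal{M}$ computes $X$. Cohesive sets: $X \subseteq^* Y$ means $X \setminus Y$ is finite. A set $C \subseteq \mathbb{N}$ is cohesive if it is infinite and for every computably enumerable set $W$, either $C \subseteq^* W$ or $C \subseteq^* \mathbb{N} \setminus W$. Cohesive power: Let $\mathcal{G}$ be a computable graph with domain $|\mathcal{G}|$ and edge relation $E$, and let $C$ be cohesive. Let $D$ be the set of partial computable functions $\varphi : \mathbb{N} \to \mathbb{N}$ such that $\varphi(n) \in |\mathcal{G}|$ whenever $\varphi(n)$ is defined, and $C \subseteq^* \mathrm{dom}(\varphi)$. For $\varphi, \psi \in D$ let $\varphi =_C \psi$ mean $C \subseteq^* \{n : \varphi(n)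 \text{ and } \psi(n) \text{ are defined and equal}\}$; this is an equivalence relation, and $[\varphi]$ denotes the class of $\varphi$. The cohesive power $\prod_C \mathcal{G}$ has domain $\{[\varphi] : \varphi \in D\}$, with an edge between $[\varphi]$ and $[\psi]$ iff $C \subseteq^* \{n : \varphi(n), \psi(n) \text{ are defined and } E(\varphi(n), \psi(n))\}$. It is again a graph. *)

(* Defs.v *)
From mathcomp Require Import all_boot.
From mathcomp Require Import boolp classical_sets functions cardinality.
From Stdlib Require Cantor.

Set Implicit Arguments.
Unset Strict Implicit.
Unset Printing Implicit Defensive.

Local Open Scope classical_set_scope.

(** * Oracle computability *)

Definition npair (a b : nat) : nat := Cantor.to_nat (a, b).
Definition nfst (n : nat) : nat := (Cantor.of_nat n).1.
Definition nsnd (n : nat) : nat := (Cantor.of_nat n).2.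

(** Programs for the unary partial recursive functions with an oracle;
    several arguments are passed through [npair]. *)
Inductive code : Type :=
  | Zero | Succ | Fst | Snd | Oracle
  | Pair of code & code
  | Comp of code & code
  | Prec of code & code
  | Mu of code.

(** Graph of the function defined by h(a, 0) = f(a),
    h(a, k + 1) = g(a, k, h(a, k)). *)
Fixpoint prec_rel (f g : nat -> nat -> Prop) (a k m : nat) : Prop :=
  match k with
  | 0 => f a m
  | k'.+1 => exists2 r, prec_rel f g a k' r & g (npair a (npair k' r)) m
  end.

(** [eval A c n m]: program [c] with oracle [A] halts on input [n] with
    output [m]. *)
Fixpoint eval (A : set nat) (c : code) (n m : nat) : Prop :=
  match c with
  | Zero => m = 0
  | Succ => m = n.+1
  | Fst => m = nfst n
  | Snd => m = nsnd n
  | Oracle => (A n /\ m = 1) \/ (~ A n /\ m = 0)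
  | Pair f g => exists a b, [/\ eval A f n a, eval A g n b & m = npair a b]
  | Comp f g => exists2 a, eval A g n a & eval A f a m
  | Prec f g => prec_rel (eval A f) (eval A g) (nfst n) (nsnd n) m
  | Mu f => eval A f (npair n m) 0 /\
            forall k, k < m -> exists r, eval A f (npair n k) r.+1
  end.

Lemma eval_det A c n m m' : eval A c n m -> eval A c n m' -> m = m'.
Proof.
elim: c n m m' => [||||| f IHf g IHg | f IHf g IHg | f IHf g IHg | f IHf] n m m' /=;
  try by move=> -> ->.
- by move=> [[? ->]|[? ->]] [[? ->]|[? ->]].
- move=> [a [b [fa gb ->]]] [a' [b' [fa' gb' ->]]].
  by rewrite (IHf _ _ _ fa fa') (IHg _ _ _ gb gb').
- move=> [a ga fm] [a' ga' fm'].
  by rewrite (IHg _ _ _ ga ga') in fm; exact: IHf fm fm'.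
- elim: (nsnd n) m m' => [|k IHk] m m' /=; first exact: IHf.
  move=> [r hr gm] [r' hr' gm'].
  by rewrite (IHk _ _ hr hr') in gm; exact: IHg gm gm'.
- move=> [f0 fS] [f0' fS']; case: (ltngtP m m') => // lt.
  + by have [r /(IHf _ _ _ f0)] := fS' _ lt.
  + by have [r /(IHf _ _ _ f0')] := fS _ lt.
Qed.

Definition turing_le (A B : set nat) : Prop :=
  exists c, forall n, (A n -> eval B c n 1) /\ (~ A n -> eval B c n 0).

Definition computable (A : set nat) : Prop := turing_le A set0.

(** Partial functions on nat; [None] means undefined. *)
Definition pfun := nat -> option nat.

Definition pdom (f : pfun) : set nat := [set n | f n <> None].

Definition partial_computable (f : pfun) : Prop :=
  exists c, forall n m, f n = Some m <-> eval set0 c n m.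

Definition ce (W : set nat) : Prop :=
  exists2 f, partial_computable f & W = pdom f.

Fixpoint godel (c : code) : nat :=
  match c with
  | Zero => npair 0 0
  | Succ => npair 1 0
  | Fst => npair 2 0
  | Snd => npair 3 0
  | Oracle => npair 4 0
  | Pair f g => npair 5 (npair (godel f) (godel g))
  | Comp f g => npair 6 (npair (godel f) (godel g))
  | Prec f g => npair 7 (npair (godel f) (godel g))
  | Mu f => npair 8 (godel f)
  end.

Lemma npair_inj a b a' b' : npair a b = npair a' b' -> a = a' /\ b = b'.
Proof. by move=> /Cantor.to_nat_inj [-> ->]. Qed.

Lemma godel_inj : injective godel.
Proof.
elim=> [||||| f IHf g IHg | f IHf g IHg | f IHf g IHg | f IHf] [] //=;
  try by move=> *; match goal with H : npair _ _ = npair _ _ |- _ =>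
    by have [] := npair_inj H end.
- by move=> f' g' /npair_inj[_ /npair_inj[/IHf -> /IHg ->]].
- by move=> f' g' /npair_inj[_ /npair_inj[/IHf -> /IHg ->]].
- by move=> f' g' /npair_inj[_ /npair_inj[/IHf -> /IHg ->]].
- by move=> f' /npair_inj[_ /IHf ->].
Qed.

(** The halting set of the [A]-computable functions; a number that is not the
    Goedel number of a program indexes the empty function. *)
Definition jump (A : set nat) : set nat :=
  [set e | exists c, godel c = e /\ exists m, eval A c e m].

(** * The arithmetical hierarchy *)

Fixpoint Sigma (k : nat) (A : set nat) : Prop :=
  match k with
  | 0 => computable A
  | k'.+1 => exists2 B, Sigma k' (~` B) & A = [set x | exists y, B (npair x y)]
  end.

Definition Pi (k : nat) (A : set nat) : Prop := Sigma k (~` A).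

Definition Delta (k : nat) (A : set nat) : Prop := Sigma k A /\ Pi k A.

(** * Cohesive sets *)

Definition almost_sub (X Y : set nat) : Prop := finite_set (X `\` Y).

Definition cohesive (C : set nat) : Prop :=
  infinite_set C /\
  forall W, ce W -> almost_sub C W \/ almost_sub C (~` W).

(** * Structures with one binary relation *)

Record structure (T : Type) := Structure {
  dom : set T;
  edge : T -> T -> Prop;
  edge_dom : forall x y, edge x y -> dom x /\ dom y
}.

Definition is_graph (T : Type) (S : structure T) : Prop :=
  (forall x y, edge S x y -> edge S y x) /\ (forall x, ~ edge S x x).

Definition isomorphic (T U : Type) (S : structure T) (M : structure U) : Prop :=
  exists f : T -> U, set_bij (dom S) (dom M) f /\
    forall x y, dom S x -> dom S y -> (edge S x y <-> edge M (f x) (f y)).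

Definition join (A B : set nat) : set nat :=
  [set n | if odd n then B n./2 else A n./2].

(** The subset of nat with which a structure on a set of numbers is
    identified. *)
Definition diagram (S : structure nat) : set nat :=
  join (dom S) [set n | edge S (nfst n) (nsnd n)].

Definition computable_graph (G : structure nat) : Prop :=
  [/\ is_graph G, dom G !=set0 & computable (diagram G)].

Definition presentation (U : Type) (M : structure U) (P : structure nat) : Prop :=
  dom P !=set0 /\ isomorphic P M.

Definition has_degree (U : Type) (M : structure U) (X : set nat) : Prop :=
  (exists2 P, presentation M P & turing_le (diagram P) X) /\
  (forall P, presentation M P -> turing_le X (diagram P)).

(** * Cohesive powers *)

Definition cp_fun (G : structure nat) (C : set nat) : set pfun :=
  [set f | [/\ partial_computable f,
               forall n x, f n = Some x -> dom G x
             & almost_sub C (pdom f)]].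

Definition eqC (C : set nat) (f g : pfun) : Prop :=
  almost_sub C [set n | exists x, f n = Some x /\ g n = Some x].

Definition cp_class (G : structure nat) (C : set nat) (f : pfun) : set pfun :=
  [set g | cp_fun G C g /\ eqC C f g].

Definition edgeC (G : structure nat) (C : set nat) (f g : pfun) : Prop :=
  almost_sub C [set n | exists x y, [/\ f n = Some x, g n = Some y & edge G x y]].

Definition cp_edge (G : structure nat) (C : set nat) (K L : set pfun) : Prop :=
  exists f g, [/\ cp_fun G C f, cp_fun G C g,
                  K = cp_class G C f, L = cp_class G C g & edgeC G C f g].

Lemma cp_edge_dom G C K L : cp_edge G C K L ->
  (cp_class G C @` cp_fun G C) K /\ (cp_class G C @` cp_fun G C) L.
Proof. by move=> [f [g [Df Dg -> -> _]]]; split; [exists f|exists g]. Qed.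

Definition cohesive_power (G : structure nat) (C : set nat) : structure (set pfun) :=
  Structure (@cp_edge_dom G C).

Lemma almost_subS X Y Z : Y `<=` Z -> almost_sub X Y -> almost_sub X Z.
Proof. by move=> YZ; apply: sub_finite_set => n [Xn nZ]; split=> // /YZ. Qed.

Lemma almost_subI X Y Z :
  almost_sub X Y -> almost_sub X Z -> almost_sub X (Y `&` Z).
Proof. by move=> ? ?; rewrite /almost_sub setDIr finite_setU. Qed.

Lemma eqC_refl G C f : cp_fun G C f -> eqC C f f.
Proof.
by move=> [_ _]; apply: almost_subS => n; rewrite /pdom /=; case: (f n) => // x _; exists x.
Qed.

Lemma eqC_sym C f g : eqC C f g -> eqC C g f.
Proof. by apply: almost_subS => n [x [? ?]]; exists x. Qed.

Lemma eqC_trans C f g h : eqC C f g -> eqC C g h -> eqC C f h.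
Proof.
move=> fg gh; apply: almost_subS (almost_subI fg gh) => n [[x [fx gx]] [y [gy hy]]].
by exists x; split=> //; rewrite hy -gy.
Qed.

Lemma cp_classP G C f g : cp_fun G C f -> cp_fun G C g ->
  (cp_class G C f = cp_class G C g) <-> eqC C f g.
Proof.
move=> Df Dg; split=> [e|fg].
  have: cp_class G C g g by split=> //; exact: eqC_refl Dg.
  by rewrite -e => -[].
apply/seteqP; split=> h [Dh e]; split=> //.
  exact: eqC_trans (eqC_sym fg) e.
exact: eqC_trans fg e.
Qed.

Lemma cp_edgeP G C f g : cp_fun G C f -> cp_fun G C g ->
  edge (cohesive_power G C) (cp_class G C f) (cp_class G C g) <-> edgeC G C f g.
Proof.
move=> Df Dg; split=> [[f' [g' [Df' Dg' /cp_classP-/(_ Df Df') ff' /cp_classP-/(_ Dg Dg') gg' e]]]|];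
  last by move=> e; exists f, g.
apply: almost_subS (almost_subI e (almost_subI ff' gg')).
move=> n [[x [y [fx gy xy]]] [[x' [fx' f'x']] [y' [gy' g'y']]]].
exists x, y; split=> //; first by rewrite fx' -f'x'.
by rewrite gy' -g'y'.
Qed.

Lemma cohesive_power_graph G C :
  is_graph G -> infinite_set C -> is_graph (cohesive_power G C).
Proof.
move=> [sym irr] infC; split=> [K L [f [g [Df Dg -> -> e]]]|K e].
  apply/cp_edgeP => //; apply: almost_subS e => n [x [y [? ? /sym ?]]].
  by exists y, x.
have [[f Df Kf] _] := edge_dom e; move: e; rewrite -Kf => /cp_edgeP-/(_ Df Df) e.
apply: infC; apply: sub_finite_set e => n Cn; split=> // -[x [y [fx fy]]].
by have -> : x = y by [move: fx; rewrite fy => -[]]; exact: irr.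
Qed.

(* Main.v *)
Require Import Defs.
From mathcomp Require Import all_boot.
From mathcomp Require Import boolp classical_sets functions cardinality.
From Stdlib Require Cantor.

(** Fix a cohesive set C. A computably enumerable set that is cofinite contains
    almost all of C, and a finite one almost none of it. Whether a sequence of
    such sets takes the first or the second form at a given place is therefore
    visible in every cohesive power, and always in the same way. The double
    jump of the empty set can be coded like that: [halts2_byP] writes
    e in 0'' as: there is x such that for all y, R(e, x, y), with R decidable, and
    - for each x, the set of the m such that R(e, x, y) for all y < m is finite,
      unless x witnesses e in 0'', when it contains every m;
    - the set of the m such that each x < m has some y with not R(e, x, y) is
      finite, unless e is not in 0'', when it contains every m.
    So e is in 0'' or not according to the kind of the set, among these, that
    contains infinitely many elements of C.

    The graph has a vertex [sample m] for each m, a vertex [link i] for each of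
    the sets above, and a vertex [witness m i t] that is joined to both of them
    if t is evidence that m lies in the i-th set. In a cohesive power the classes
    of [sample] and of the constant [link i] have a common neighbour if and only
    if the i-th set contains almost all of C. Hence a copy of the power
    decides 0'' by a search, as soon as it can locate the classes of the
    constants [link i]. For this the links form a path, marked by a common
    neighbour [hub]: a class adjacent to [link i] and to [hub] is, by
    cohesiveness, one of the two neighbours of [link i] on the path. This is
    [copy_computes_double_jump].

    Conversely ([cohesive_power_copy]) let C be Delta_2. Then 0' decides
    membership in C, and also whether a given program halts on a given input.
    So 0'' decides whether a program halts on all elements of C above a
    given k, and whether it halts on none of them. By cohesiveness one of the
    two holds for some k, and a search finds out which. Equality and adjacency
    of the classes of two programs are of this form, for a third program whose
    Goedel number is computed from theirs, so the least Goedel numbers of the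
    classes carry a copy of the power computable in 0''.

    The normal form [halts2_byP] rests on finite tables of claims about programs
    in which every claim follows, by one rule of the evaluation semantics,
    from other claims of the table: a program halts if and only if such a table
    says so, and it is decidable whether a number codes such a table. *)

Set Implicit Arguments.
Unset Strict Implicit.
Unset Printing Implicit Defensive.

Local Open Scope classical_set_scope.

(** * The pairing function *)

Lemma nfst_pair a b : nfst (npair a b) = a.
Proof. by rewrite /nfst /npair Cantor.cancel_of_to. Qed.

Lemma nsnd_pair a b : nsnd (npair a b) = b.
Proof. by rewrite /nsnd /npair Cantor.cancel_of_to. Qed.

Lemma npairK n : npair (nfst n) (nsnd n) = n.
Proof. by rewrite /npair /nfst /nsnd -surjective_pairing Cantor.cancel_to_of. Qed.

Definition npE := (nfst_pair, nsnd_pair).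

Lemma addn_npair a b : a + b <= npair a b.
Proof. by have /leP := Cantor.to_nat_non_decreasing a b; rewrite addnC. Qed.

Lemma nfst_le n : nfst n <= n.
Proof. by rewrite -{2}(npairK n) (leq_trans _ (addn_npair _ _)) ?leq_addr. Qed.

Lemma nsnd_le n : nsnd n <= n.
Proof. by rewrite -{2}(npairK n) (leq_trans _ (addn_npair _ _)) ?leq_addl. Qed.

Lemma npair_gt a b : 0 < a -> b < npair a b.
Proof. by move=> a0; rewrite (leq_trans _ (addn_npair _ _)) // -add1n leq_add2r. Qed.

(* Goedel numbers of programs are unary numerals of astronomic size: conversion
   has to leave pairs alone. *)
#[global] Opaque npair nfst nsnd.

(** * Functions and predicates recursive in an oracle *)

Definition recf (A : set nat) (f : nat -> nat) : Prop :=
  exists c, forall n, eval A c n (f n).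

Definition recp (A : set nat) (p : nat -> bool) : Prop :=
  recf A (fun n => nat_of_bool (p n)).

Lemma recf_eq A f g : f =1 g -> recf A f -> recf A g.
Proof. by move=> fg [c cf]; exists c => n; rewrite -fg. Qed.

Lemma recp_eq A p q : p =1 q -> recp A p -> recp A q.
Proof. by move=> pq; apply: recf_eq => n; rewrite pq. Qed.

Lemma recf_id A : recf A id.
Proof. by exists (Pair Fst Snd) => n; exists (nfst n), (nsnd n); rewrite npairK. Qed.

Lemma recf_comp A g f : recf A g -> recf A f -> recf A (fun n => g (f n)).
Proof. by move=> [d dg] [c cf]; exists (Comp d c) => n; exists (f n). Qed.

Lemma recp_comp A p f : recp A p -> recf A f -> recp A (fun n => p (f n)).
Proof. exact: recf_comp. Qed.

Fixpoint constc (k : nat) : code :=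
  if k is k'.+1 then Comp Succ (constc k') else Zero.

Lemma eval_constc A k n : eval A (constc k) n k.
Proof. by elim: k => //= k IHk; exists k. Qed.

Lemma recf_const A k : recf A (fun=> k).
Proof. by exists (constc k) => n; exact: eval_constc. Qed.

Lemma recf_succ A f : recf A f -> recf A (fun n => (f n).+1).
Proof. by apply: (@recf_comp _ succn); exists Succ. Qed.

Lemma recf_fst A f : recf A f -> recf A (fun n => nfst (f n)).
Proof. by apply: recf_comp; exists Fst. Qed.

Lemma recf_snd A f : recf A f -> recf A (fun n => nsnd (f n)).
Proof. by apply: recf_comp; exists Snd. Qed.

Lemma recf_pair A f g : recf A f -> recf A g -> recf A (fun n => npair (f n) (g n)).
Proof. by move=> [c cf] [d dg]; exists (Pair c d) => n; exists (f n), (g n). Qed.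

Lemma recp_oracle A : recp A (fun n => `[< A n >]).
Proof.
by exists Oracle => n; case: asboolP => /= An; [left | right].
Qed.

(** Hypotheses about a function of several variables take its arguments packed
    into one number; this turns them into a rule for compound expressions. *)
Lemma recf_app2 A F f g :
  recf A (fun q => F (nfst q) (nsnd q)) -> recf A f -> recf A g ->
  recf A (fun n => F (f n) (g n)).
Proof.
move=> rF rf rg; apply: recf_eq (recf_comp rF (recf_pair rf rg)) => n.
by rewrite !npE.
Qed.

Lemma recp_app2 A P f g :
  recp A (fun q => P (nfst q) (nsnd q)) -> recf A f -> recf A g ->
  recp A (fun n => P (f n) (g n)).
Proof. exact: (@recf_app2 A (fun x y => nat_of_bool (P x y))). Qed.

(** The only use of primitive recursion: the further closure properties
    exhibit a function as an iteration. *)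
Lemma recf_iteri A k s b :
  recf A k -> recf A (fun q => s (nfst q) (nfst (nsnd q)) (nsnd (nsnd q))) ->
  recf A b -> recf A (fun n => iteri (k n) (s n) (b n)).
Proof.
move=> rk [d ds] [c cb]; suff rI : recf A (fun q => iteri (nsnd q) (s (nfst q)) (b (nfst q))).
  apply: recf_eq (recf_comp rI (recf_pair (recf_id A) rk)) => n.
  by rewrite !npE.
exists (Prec c d) => q /=; elim: (nsnd q) => [|i IHi] //=.
set r := iteri _ _ _ in IHi *; exists r => //.
by move: (ds (npair (nfst q) (npair i r))); rewrite !npE.
Qed.

Lemma recf_if A b f g :
  recp A b -> recf A f -> recf A g -> recf A (fun n => if b n then f n else g n).
Proof.
move=> rb rf rg; have rI : recf A (fun n => iteri (b n) (fun _ _ => f n) (g n)).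
  by apply: recf_iteri => //; apply: recf_comp (recf_fst (recf_id A)).
by apply: recf_eq rI => n; case: (b n).
Qed.

Lemma recp_if A b p q :
  recp A b -> recp A p -> recp A q -> recp A (fun n => if b n then p n else q n).
Proof.
by move=> rb rp rq; apply: recf_eq (recf_if rb rp rq) => n; case: (b n).
Qed.

Lemma recp_const A b : recp A (fun=> b).
Proof. exact: recf_const. Qed.

Lemma recp_neg A p : recp A p -> recp A (fun n => ~~ p n).
Proof.
move=> rp; apply: recp_eq (recp_if rp (recp_const A false) (recp_const A true)) => n.
by case: (p n).
Qed.

Lemma recp_and A p q : recp A p -> recp A q -> recp A (fun n => p n && q n).
Proof. by move=> rp rq; exact: recp_if rp rq (recp_const A false). Qed.

Lemma recp_or A p q : recp A p -> recp A q -> recp A (fun n => p n || q n).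
Proof. by move=> rp rq; exact: recp_if rp (recp_const A true) rq. Qed.

Lemma recf_pred A f : recf A f -> recf A (fun n => (f n).-1).
Proof.
move=> rf; have rI : recf A (fun n => iteri (f n) (fun i _ => i) 0).
  by apply: recf_iteri (recf_const A 0) => //; apply/recf_fst/recf_snd/recf_id.
by apply: recf_eq rI => n; case: (f n).
Qed.

Lemma recf_sub A f g : recf A f -> recf A g -> recf A (fun n => f n - g n).
Proof.
move=> rf rg; have rI : recf A (fun n => iteri (g n) (fun _ r => r.-1) (f n)).
  by apply: recf_iteri => //; apply/recf_pred/recf_snd/recf_snd/recf_id.
by apply: recf_eq rI => n; elim: (g n) => [|k IHk] /=; rewrite ?subn0 // IHk subnS.
Qed.

Lemma recp_eq0 A f : recf A f -> recp A (fun n => f n == 0).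
Proof.
move=> rf; have rI : recf A (fun n => iteri (f n) (fun _ _ => 0) 1).
  by apply: recf_iteri => //; exact: recf_const.
by apply: recf_eq rI => n; case: (f n).
Qed.

Lemma recp_leq A f g : recf A f -> recf A g -> recp A (fun n => f n <= g n).
Proof. by move=> rf rg; exact: recp_eq0 (recf_sub rf rg). Qed.

Lemma recp_eqn A f g : recf A f -> recf A g -> recp A (fun n => f n == g n).
Proof.
move=> rf rg; apply: recp_eq (recp_and (recp_leq rf rg) (recp_leq rg rf)) => n.
by rewrite eqn_leq.
Qed.

Lemma recp_odd A f : recf A f -> recp A (fun n => odd (f n)).
Proof.
move=> rf; have rI : recf A (fun n => iteri (f n) (fun _ r => nat_of_bool (r == 0)) 0).
  apply: recf_iteri (recf_const A 0) => //.
  by apply: recp_eq0; apply/recf_snd/recf_snd/recf_id.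
by apply: recf_eq rI => n; elim: (f n) => //= k ->; rewrite eqb0.
Qed.

Lemma recf_half A f : recf A f -> recf A (fun n => (f n)./2).
Proof.
move=> rf; have rI : recf A (fun n => iteri (f n) (fun i r => if odd i then r.+1 else r) 0).
  apply: recf_iteri (recf_const A 0) => //; apply: recf_if.
  - by apply/recp_odd/recf_fst/recf_snd/recf_id.
  - by apply/recf_succ/recf_snd/recf_snd/recf_id.
  - by apply/recf_snd/recf_snd/recf_id.
apply: recf_eq rI => n; elim: (f n) => //= k ->.
by rewrite uphalf_half; case: (odd k).
Qed.

Lemma recp_has A p k :
  recp A (fun q => p (nfst q) (nsnd q)) -> recf A k ->
  recp A (fun n => has (p n) (iota 0 (k n))).
Proof.
move=> rp rk.
have rI : recf A (fun n => iteri (k n) (fun i r => nat_of_bool ((r != 0) || p n i)) 0).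
  apply: recf_iteri (recf_const A 0) => //; apply: recp_or.
    by apply/recp_neg/recp_eq0/recf_snd/recf_snd/recf_id.
  by apply: recp_app2 rp _ _; [exact/recf_fst/recf_id | exact/recf_fst/recf_snd/recf_id].
apply: recf_eq rI => n; elim: (k n) => // i IHi.
by rewrite -[in RHS](addn1 i) iotaD has_cat /= IHi orbF eqb0 negbK.
Qed.

Lemma recp_all A p k :
  recp A (fun q => p (nfst q) (nsnd q)) -> recf A k ->
  recp A (fun n => all (p n) (iota 0 (k n))).
Proof.
move=> rp rk; apply: recp_eq (recp_neg (recp_has (p := fun n i => ~~ p n i) (recp_neg rp) rk)) => n.
by rewrite has_predC negbK.
Qed.

Lemma recf_mu A p :
  recp A (fun q => p (nfst q) (nsnd q)) -> (forall n, exists m, p n m) ->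
  exists2 f, recf A f & forall n, p n (f n).
Proof.
move=> /recp_neg [c cp] ex; exists (fun n => ex_minn (ex n)); last by move=> n; case: ex_minnP.
exists (Mu c) => n; case: ex_minnP => m pm minm /=.
have cE k : eval A c (npair n k) (~~ p n k) by move: (cp (npair n k)); rewrite !npE.
split=> [|k km]; first by move: (cE m); rewrite pm.
exists 0; move: (cE k); case pk: (p n k) => //=.
by move: (minm _ pk); rewrite leqNgt km.
Qed.

(** Descends through an expression built from the operations above. *)
Ltac rec_step := lazymatch goal with
  | H : ?P |- ?P => exact: H
  | H : recf ?A ?f |- recf ?A (fun n => ?f _) => apply: (recf_comp H)
  | H : recp ?A ?p |- recp ?A (fun n => ?p _) => apply: (recp_comp H)
  | |- recf _ (fun n => n) => exact: recf_id
  | |- recf _ nfst => exact/recf_fst/recf_id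
  | |- recf _ nsnd => exact/recf_snd/recf_id
  | |- recf _ succn => exact/recf_succ/recf_id
  | |- recf _ (fun=> ?k) => exact: (recf_const _ k)
  | |- recf _ (fun n => S _) => apply: recf_succ
  | |- recf _ (fun n => predn _) => apply: recf_pred
  | |- recf _ (fun n => nfst _) => apply: recf_fst
  | |- recf _ (fun n => nsnd _) => apply: recf_snd
  | |- recf _ (fun n => npair _ _) => apply: recf_pair
  | |- recf _ (fun n => half _) => apply: recf_half
  | |- recf _ (fun n => nat_of_bool _) =>
      change (recf ?A (fun n => nat_of_bool (@?p n))) with (recp A p)
  | |- recp _ (fun=> ?b) => exact: (recp_const _ b)
  | |- recp _ (fun n => odd _) => apply: recp_odd
  | |- recp _ (fun n => ~~ _) => apply: recp_neg
  | |- recp _ (fun n => _ && _) => apply: recp_and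
  | |- recp _ (fun n => _ || _) => apply: recp_or
  | |- recp _ (fun n => _ == _) => apply: recp_eqn
  | |- recp _ (fun n => _ <= _) => apply: recp_leq
  | |- recp _ (fun n => if _ then _ else _) => apply: recp_if
  | |- recp _ (fun n => has _ (iota 0 _)) => apply: recp_has
  | |- recp _ (fun n => all _ (iota 0 _)) => apply: recp_all
  end.
Ltac rec_solve := repeat rec_step.


(** * Semidecidability and the jump *)

Definition semirec (A : set nat) (P : nat -> Prop) : Prop :=
  exists c, forall n, P n <-> exists m, eval A c n m.

Lemma semirec_ex A p :
  recp A (fun q => p (nfst q) (nsnd q)) -> semirec A (fun n => exists m, p n m).
Proof.
move=> /recp_neg [c cp]; exists (Mu c) => n.
have cE k : eval A c (npair n k) (~~ p n k) by move: (cp (npair n k)); rewrite !npE.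
split=> [ex|[m [c0 _]]]; last first.
  by exists m; have := eval_det c0 (cE m); case: (p n m).
case: (ex_minnP ex) => m pm minm; exists m; split; first by move: (cE m); rewrite pm.
move=> k km; exists 0; move: (cE k); case pk: (p n k) => //=.
by move: (minm _ pk); rewrite leqNgt km.
Qed.

Definition halts (A : set nat) (e n : nat) : Prop :=
  exists c, godel c = e /\ exists m, eval A c n m.

Definition const_index (k : nat) : nat :=
  iteri k (fun _ r => npair 6 (npair (godel Succ) r)) (godel Zero).

Lemma const_indexE k : const_index k = godel (constc k).
Proof. by elim: k => // k IHk; rewrite /const_index iteriS -/(const_index k) IHk. Qed.

(** The jump only asks programs about their own Goedel number. A program that
    replaces its input by the constant n turns this into the question whether
    the program e halts on n. *)
Definition fix_input (e n : nat) : nat := npair 6 (npair e (const_index n)).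

Lemma recf_fix_input A f g :
  recf A f -> recf A g -> recf A (fun n => fix_input (f n) (g n)).
Proof.
move=> rf rg; rewrite /fix_input /const_index; rec_solve.
by apply: recf_iteri => //; rec_solve.
Qed.

Lemma jump_fix_input A e n : jump A (fix_input e n) <-> halts A e n.
Proof.
rewrite /fix_input const_indexE; split=> [[c [cE [m]]]|[c [<- [m cm]]]]; last first.
  by exists (Comp c (constc n)); split=> //; exists m, n => //; exact: eval_constc.
case: c cE => [||||| ? ? | f g | ? ? | ?] /npair_inj[] // _ /npair_inj[fE /godel_inj ->].
by move=> [a /(eval_det (eval_constc _ _ _)) <- fm]; exists f; split=> //; exists m.
Qed.

Lemma recp_halts A f g :
  recf (jump A) f -> recf (jump A) g -> recp (jump A) (fun n => `[< halts A (f n) (g n) >]).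
Proof.
move=> rf rg; apply: recp_eq (recp_comp (recp_oracle _) (recf_fix_input rf rg)) => n.
exact/asbool_equiv_eq/jump_fix_input.
Qed.

Lemma semirec_jump A P : semirec A P -> recp (jump A) (fun n => `[< P n >]).
Proof.
move=> [c cP]; apply: recp_eq (recp_halts (recf_const _ (godel c)) (recf_id _)) => n.
apply: asbool_equiv_eq; split=> [[d [/godel_inj -> /cP]] //|/cP].
by exists c.
Qed.

(** * The Kleene normal form *)

(** A table lists two kinds of claims: that the program e returns m on input n,
    and that e is the Goedel number of a program. The second kind is there for
    primitive recursion, which with 0 steps never runs its second program: no
    computation then shows that it is one. *)
Definition eval_claim (e n m : nat) : nat := npair 0 (npair e (npair n m)).
Definition code_claim (e : nat) : nat := npair 1 e.

(** The rule that the evaluation semantics provides for the claim that e returns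
    m on n, with premises in M. The bound B limits the intermediate results, so
    that the rule is decidable, and it is passed on to O, which approximates the
    answers of the oracle. *)
Definition eval_rule (O : nat -> nat -> nat -> bool) (M : nat -> bool) (B e n m : nat) : bool :=
  let k := nfst e in let a := nfst (nsnd e) in let b := nsnd (nsnd e) in
  let i := (nsnd n).-1 in
  if k == 0 then (nsnd e == 0) && (m == 0) else
  if k == 1 then (nsnd e == 0) && (m == n.+1) else
  if k == 2 then (nsnd e == 0) && (m == nfst n) else
  if k == 3 then (nsnd e == 0) && (m == nsnd n) else
  if k == 4 then (nsnd e == 0) && O B n m else
  if k == 5 then M (eval_claim a n (nfst m)) && M (eval_claim b n (nsnd m)) else
  if k == 6 then
    has (fun r => M (eval_claim b n r) && M (eval_claim a r m)) (iota 0 B) else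
  if k == 7 then
    if nsnd n == 0 then M (eval_claim a (nfst n) m) && M (code_claim b) else
    has (fun r => M (eval_claim e (npair (nfst n) i) r) &&
                  M (eval_claim b (npair (nfst n) (npair i r)) m)) (iota 0 B) else
  if k == 8 then
    M (eval_claim (nsnd e) (npair n m) 0) &&
    all (fun j => has (fun r => M (eval_claim (nsnd e) (npair n j) r.+1)) (iota 0 B))
        (iota 0 m)
  else false.

Definition code_rule (M : nat -> bool) (e : nat) : bool :=
  if nfst e <= 4 then nsnd e == 0 else
  if nfst e <= 7 then M (code_claim (nfst (nsnd e))) && M (code_claim (nsnd (nsnd e))) else
  if nfst e == 8 then M (code_claim (nsnd e)) else false.

Definition justified O M B x : bool :=
  if nfst x == 0 then
    eval_rule O M B (nfst (nsnd x)) (nfst (nsnd (nsnd x))) (nsnd (nsnd (nsnd x)))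
  else code_rule M (nsnd x).

Lemma justified_eval O M B e n m :
  justified O M B (eval_claim e n m) = eval_rule O M B e n m.
Proof. by rewrite /justified !npE. Qed.

Lemma justified_code O M B e : justified O M B (code_claim e) = code_rule M e.
Proof. by rewrite /justified !npE. Qed.

(** A table is a pair of a length and a list, a list being an iterated pair. The
    number of the table itself serves as the bound on intermediate results. *)
Definition entry (i t : nat) : nat := nfst (iteri i (fun _ => nsnd) t).

Definition in_table (T x : nat) : bool :=
  has (fun i => entry i (nsnd T) == x) (iota 0 (nfst T)).

Definition closed O (T : nat) : bool :=
  all (fun i => justified O (in_table T) T (entry i (nsnd T))) (iota 0 (nfst T)).

Definition accepts O (T e : nat) : bool :=
  closed O T && has (fun m => in_table T (eval_claim e e m)) (iota 0 T).

Lemma closedP O T :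
  reflect (forall x, in_table T x -> justified O (in_table T) T x) (closed O T).
Proof.
apply: (iffP allP) => H x; first by move=> /hasP[i iT /eqP <-]; exact: H.
by move=> xT; apply: H; apply/hasP; exists x.
Qed.

Definition table_of (B : nat) (l : seq nat) : nat := npair (size l) (foldr npair B l).

Lemma table_of_ge B l : B <= table_of B l.
Proof.
apply: leq_trans (leq_trans (leq_addl _ _) (addn_npair _ _)).
by elim: l => //= x l IHl; apply: leq_trans IHl (leq_trans (leq_addl _ _) (addn_npair _ _)).
Qed.

Lemma entry_table B l i : i < size l -> entry i (foldr npair B l) = nth 0 l i.
Proof.
rewrite /entry; have sK j t : iteri j.+1 (fun _ => nsnd) t = iteri j (fun _ => nsnd) (nsnd t).
  by elim: j => //= j ->.
elim: l i => [|y l IHl] [|i] //= lti; first by rewrite npE.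
by rewrite -[nsnd _]/(iteri i.+1 (fun _ => nsnd) _) sK npE IHl.
Qed.

Lemma in_table_of B l x : in_table (table_of B l) x = (x \in l).
Proof.
rewrite /in_table /table_of !npE; apply/hasP/(nthP 0) => [[i]|[i ltil <-]].
  by rewrite mem_iota /= add0n => lti /eqP <-; exists i => //; rewrite entry_table.
by exists i; rewrite ?mem_iota // entry_table.
Qed.

Lemma npairP n : exists a b, n = npair a b.
Proof. by exists (nfst n), (nsnd n); rewrite npairK. Qed.

(** Premises speak of programs with smaller Goedel numbers, which excludes
    circular justifications. *)
Lemma closed_code O T e : closed O T -> in_table T (code_claim e) -> exists c, godel c = e.
Proof.
move=> /closedP clT; elim/ltn_ind: e => e IHe /clT; rewrite justified_code /code_rule.
have [k [a eE]] := npairP e; rewrite eE !npE.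
have {}IHe a' : 0 < k -> a' <= a -> in_table T (code_claim a') -> exists c, godel c = a'.
  by move=> k0 lea; apply: IHe; rewrite eE; exact: leq_ltn_trans lea (npair_gt _ k0).
have IHp : 0 < k -> in_table T (code_claim (nfst a)) && in_table T (code_claim (nsnd a)) ->
    exists f g, a = npair (godel f) (godel g).
  move=> k0 /andP[/(IHe _ k0 (nfst_le _))[f fE] /(IHe _ k0 (nsnd_le _))[g gE]].
  by exists f, g; rewrite fE gE npairK.
case: k {eE} IHe IHp => [|[|[|[|[|[|[|[|[|k]]]]]]]]] IHe IHp //=.
- by move=> /eqP ->; exists Zero.
- by move=> /eqP ->; exists Succ.
- by move=> /eqP ->; exists Fst.
- by move=> /eqP ->; exists Snd.
- by move=> /eqP ->; exists Oracle.
- by move=> /IHp[// | f [g ->]]; exists (Pair f g).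
- by move=> /IHp[// | f [g ->]]; exists (Comp f g).
- by move=> /IHp[// | f [g ->]]; exists (Prec f g).
- by move=> /(IHe _ isT (leqnn _))[f <-]; exists (Mu f).
Qed.

(** The answer m of the oracle A to n is a limit of the approximations
    [O B n m]. Monotony allows to enlarge the bound of a table. *)
Definition oracle_spec (A : set nat) (O : nat -> nat -> nat -> bool) : Prop :=
  (forall B B' n m, B <= B' -> O B n m -> O B' n m) /\
  (forall n m, (exists B, O B n m) <-> eval A Oracle n m).

(** The premises concern smaller Goedel numbers or, for primitive recursion,
    the same program with fewer steps. *)
Lemma closed_eval A O T e n m : oracle_spec A O -> closed O T ->
  in_table T (eval_claim e n m) -> exists2 c, godel c = e & eval A c n m.
Proof.
move=> [_ OA] clO; have /closedP clT := clO.
elim/ltn_ind: e n m => e IHe n m /clT; rewrite justified_eval /eval_rule.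
have [k [a eE]] := npairP e; rewrite eE !npE.
have {}IHe a' n' m' : 0 < k -> a' <= a -> in_table T (eval_claim a' n' m') ->
    exists2 c, godel c = a' & eval A c n' m'.
  by move=> k0 lea; apply: IHe; rewrite eE; exact: leq_ltn_trans lea (npair_gt _ k0).
have [f [g aE]] := npairP a; rewrite aE !npE.
have lefa : f <= a by rewrite -[f](nfst_pair f g) -aE nfst_le.
have lega : g <= a by rewrite -[g](nsnd_pair f g) -aE nsnd_le.
have IHf n' m' k0 := IHe f n' m' k0 lefa.
have IHg n' m' k0 := IHe g n' m' k0 lega.
case: k eE IHe IHf IHg => [|[|[|[|[|[|[|[|[|k]]]]]]]]] eE IHe IHf IHg //=.
- by move=> /andP[/eqP -> /eqP ->]; exists Zero.
- by move=> /andP[/eqP -> /eqP ->]; exists Succ.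
- by move=> /andP[/eqP -> /eqP ->]; exists Fst.
- by move=> /andP[/eqP -> /eqP ->]; exists Snd.
- by move=> /andP[/eqP -> On]; exists Oracle => //; apply/OA; exists T.
- move=> /andP[/(IHf _ _ isT)[c <- cn] /(IHg _ _ isT)[d <- dn]].
  by exists (Pair c d) => //; exists (nfst m), (nsnd m); rewrite npairK.
- move=> /hasP[r _ /andP[/(IHg _ _ isT)[d <- dn] /(IHf _ _ isT)[c <- cr]]].
  by exists (Comp c d) => //; exists r.
- have [x [i nE]] := npairP n; rewrite nE !npE.
  suff: forall i m, (if i == 0 then
      in_table T (eval_claim f x m) && in_table T (code_claim g)
    else has (fun r => in_table T (eval_claim (npair 7 (npair f g)) (npair x i.-1) r) &&
           in_table T (eval_claim g (npair x (npair i.-1 r)) m)) (iota 0 T)) ->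
    exists c d, [/\ godel c = f, godel d = g & prec_rel (eval A c) (eval A d) x i m].
    move=> H /H[c [d [<- <- cd]]]; exists (Prec c d) => //=.
    by rewrite !npE.
  elim=> [|j IHj] {}m /=.
    by move=> /andP[/(IHf _ _ isT)[c <- cx] /(closed_code clO)[d <-]]; exists c, d.
  move=> /hasP[r _ /andP[/clT]]; rewrite justified_eval /eval_rule !npE /=.
  move=> /IHj[c [d [<- dE cd]]] /(IHg _ _ isT)[d']; rewrite -dE => /godel_inj -> dm.
  by exists c, d; split=> //; exists r.
- rewrite -aE => /andP[/(IHe _ _ _ isT (leqnn _))[c cE c0] /allP H].
  exists (Mu c); first by rewrite -cE.
  split; first exact: c0.
  move=> j jm.
  have /H/hasP[r _] : j \in iota 0 m by rewrite mem_iota.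
  by move=> /(IHe _ _ _ isT (leqnn _))[d]; rewrite -cE => /godel_inj -> dj; exists r.
Qed.

Lemma justified_mono A O (M M' : nat -> bool) B B' x : oracle_spec A O ->
  (forall y, M y -> M' y) -> B <= B' -> justified O M B x -> justified O M' B' x.
Proof.
move=> [O_mono _] MM' BB'; rewrite /justified /eval_rule /code_rule.
have hasS (p q : nat -> bool) : (forall r, p r -> q r) ->
    has p (iota 0 B) -> has q (iota 0 B').
  move=> pq /hasP[r]; rewrite mem_iota /= add0n => ltr /pq qr; apply/hasP; exists r => //.
  by rewrite mem_iota /= add0n (leq_trans ltr).
case: (nfst x) => [|_] /=; last first.
  case: (nfst (nsnd x)) => [|[|[|[|[|[|[|[|[|k]]]]]]]]] //=; last exact: MM'.
  - by move=> /andP[/MM' -> /MM' ->].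
  - by move=> /andP[/MM' -> /MM' ->].
  - by move=> /andP[/MM' -> /MM' ->].
case: (nfst (nfst (nsnd x))) => [|[|[|[|[|[|[|[|[|k]]]]]]]]] //=.
- by move=> /andP[-> /(O_mono _ _ _ _ BB')].
- by move=> /andP[/MM' -> /MM' ->].
- by apply: hasS => r /andP[/MM' -> /MM' ->].
- case: (_ == 0); first by move=> /andP[/MM' -> /MM' ->].
  by apply: hasS => r /andP[/MM' -> /MM' ->].
- move=> /andP[/MM' -> /allP H]; apply/allP => j /H.
  by apply: hasS => r /MM'.
Qed.

(** Tables before coding: a finite set of claims with a bound of its own. *)
Definition derivable O (x : nat) : Prop :=
  exists B (l : seq nat), x \in l /\ forall y, y \in l -> justified O (fun z => z \in l) B y.

(** Finite sets of claims can be merged because justification is monotone. *)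
Lemma derivable_step A O B x (xs : seq nat) : oracle_spec A O ->
  (forall y, y \in xs -> derivable O y) -> justified O (fun z => z \in xs) B x -> derivable O x.
Proof.
move=> OA dxs jx; suff [B' [l [xsl lP]]] : exists B' (l : seq nat), {subset xs <= l} /\
    forall y, y \in l -> justified O (fun z => z \in l) B' y.
  exists (maxn B B'), (x :: l); split=> [|y]; first exact: mem_head.
  rewrite in_cons => /orP[/eqP ->|/lP].
    refine (justified_mono OA _ (leq_maxl _ _) jx) => z /xsl /= zl.
    by rewrite in_cons zl orbT.
  by refine (justified_mono OA _ (leq_maxr _ _)) => z /= zl; rewrite in_cons zl orbT.
elim: xs dxs {jx} => [|y xs IHxs] dxs; first by exists 0, [::].
have [B1 [l1 [yl1 l1P]]] := dxs _ (mem_head _ _).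
have [z zxs|B2 [l2 [xsl2 l2P]]] := IHxs.
  by apply: dxs; rewrite in_cons zxs orbT.
exists (maxn B1 B2), (l1 ++ l2); split=> z.
  by rewrite in_cons mem_cat => /orP[/eqP ->|/xsl2 ->]; rewrite ?yl1 ?orbT.
rewrite mem_cat => /orP[/l1P|/l2P].
  by refine (justified_mono OA _ (leq_maxl _ _)) => w /= wl; rewrite mem_cat wl.
by refine (justified_mono OA _ (leq_maxr _ _)) => w /= wl; rewrite mem_cat wl orbT.
Qed.

Lemma derivable_code A O c : oracle_spec A O -> derivable O (code_claim (godel c)).
Proof.
move=> OA; have step := derivable_step OA.
elim: c => [||||| f IHf g IHg | f IHf g IHg | f IHf g IHg | f IHf];
  try by apply: (step 0 _ [::]) => //; rewrite justified_code /code_rule /= !npE.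
4: apply: (step 0 _ [:: code_claim (godel f)]) => [y|];
  [by rewrite !inE => /eqP -> | by rewrite justified_code /code_rule /= !npE /= !inE !eqxx].
all: apply: (step 0 _ [:: code_claim (godel f); code_claim (godel g)]) => [y|];
  [by rewrite !inE => /orP[] /eqP ->
  |by rewrite justified_code /code_rule /= !npE /= !inE !eqxx orbT].
Qed.

Lemma has_iota_S (p : nat -> bool) r : p r -> has p (iota 0 r.+1).
Proof. by move=> pr; apply/hasP; exists r => //; rewrite mem_iota add0n ltnSn. Qed.

Lemma derivable_eval A O c n m : oracle_spec A O ->
  eval A c n m -> derivable O (eval_claim (godel c) n m).
Proof.
move=> OA; have step := derivable_step OA.
elim: c n m => [||||| f IHf g IHg | f IHf g IHg | f IHf g IHg | f IHf] n m.
1-4: move=> /= ->; apply: (step 0 _ [::]) => //;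
  by rewrite justified_eval /eval_rule !npE /=.
- move=> /OA.2[B On]; apply: (step B _ [::]) => //.
  by rewrite justified_eval /eval_rule !npE /=.
- move=> /= [a [b [/IHf fa /IHg gb ->]]].
  apply: (step 0 _ [:: eval_claim (godel f) n a; eval_claim (godel g) n b]) => [y|].
    by rewrite !inE => /orP[] /eqP ->.
  by rewrite justified_eval /eval_rule !npE /= !inE !eqxx orbT.
- move=> /= [a /IHg ga /IHf fa].
  apply: (step a.+1 _ [:: eval_claim (godel g) n a; eval_claim (godel f) a m]) => [y|].
    by rewrite !inE => /orP[] /eqP ->.
  rewrite justified_eval /eval_rule !npE -[6 == 0]/false -[6 == 6]/true.
  by apply: (has_iota_S (r := a)); rewrite /= !inE !eqxx orbT.
- rewrite -(npairK n) /= !npE; elim: (nsnd n) m => [|k IHk] m /=.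
    move=> /IHf fm; have dg := derivable_code g OA.
    apply: (step 0 _ [:: eval_claim (godel f) (nfst n) m; code_claim (godel g)]) => [y|].
      by rewrite !inE => /orP[] /eqP ->.
    by rewrite justified_eval /eval_rule !npE /= !inE !eqxx orbT.
  move=> [r /IHk dr /IHg gm].
  apply: (step r.+1 _ [:: eval_claim (godel (Prec f g)) (npair (nfst n) k) r;
    eval_claim (godel g) (npair (nfst n) (npair k r)) m]) => [y|].
    by rewrite !inE => /orP[] /eqP ->.
  rewrite justified_eval /eval_rule !npE -[7 == 0]/false -[7 == 7]/true.
  by apply: (has_iota_S (r := r)); rewrite /= !inE !eqxx orbT.
(* The bound of the new claim has to cover all the nonzero values that the
   minimisation passes over. *)
- move=> [/IHf f0 fS].
  have /boolp.choice[r rP] : forall j, exists r, j < m -> eval A f (npair n j) r.+1.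
    by move=> j; case: (ltnP j m) => [/fS[r]|_]; [exists r | exists 0].
  pose v j := eval_claim (godel f) (npair n j) (r j).+1.
  have [B rB] : exists B, forall j, j < m -> r j < B.
    by exists (\max_(j < m) r j).+1 => j jm; exact: (leq_bigmax (Ordinal jm)).
  apply: (step B _ (eval_claim (godel f) (npair n m) 0 :: map v (iota 0 m))) => [y|].
    rewrite inE => /orP[/eqP -> //|/mapP[j]].
    by rewrite mem_iota add0n /= => jm ->; apply/IHf/rP.
  rewrite justified_eval /eval_rule !npE -[8 == 0]/false -[8 == 8]/true.
  rewrite /= inE eqxx; apply/allP => j jm; apply/hasP; exists (r j).
    by rewrite mem_iota add0n rB //; move: jm; rewrite mem_iota.
  by rewrite /= inE; apply/orP; right; exact: (map_f v).
Qed.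

Lemma derivable_table A O x B : oracle_spec A O -> derivable O x ->
  exists T, [/\ B <= T, closed O T & in_table T x].
Proof.
move=> OA [B' [l [xl lP]]]; exists (table_of (maxn B B') l).
split; last by rewrite in_table_of.
  by apply: leq_trans (table_of_ge _ _); exact: leq_maxl.
apply/closedP => y; rewrite in_table_of => /lP; apply: (justified_mono OA) => [z /= zl|].
  by rewrite in_table_of.
by apply: leq_trans (table_of_ge _ _); exact: leq_maxr.
Qed.

Lemma accepts_jump A O e : oracle_spec A O -> (exists T, accepts O T e) <-> jump A e.
Proof.
move=> OA; split=> [[T /andP[clT /hasP[m _ /(closed_eval OA clT)[c cE cm]]]]|].
  by exists c; split=> //; exists m.
move=> [c [<- [m /(derivable_eval OA) /(derivable_table m.+1 OA)]]] [T [mT clT cT]].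
exists T; rewrite /accepts clT; apply/hasP; exists m => //.
by rewrite mem_iota.
Qed.

(** The empty oracle answers 0 to everything. *)
Definition halt_oracle (B n m : nat) : bool := m == 0.

Definition halts_by (s n : nat) : bool := accepts halt_oracle s n.

(** Answers of the oracle 0': the answer 1 is confirmed by a computation below
    the bound, the answer 0 is merely not refuted by y. The confirmations
    belong to the existential part of the normal form, the refutations to the
    universal one. *)
Definition jump_oracle (y B n m : nat) : bool :=
  if m == 0 then ~~ halts_by y n else (m == 1) && has (fun s => halts_by s n) (iota 0 B).

Definition halts2_by (e x y : nat) : bool := accepts (jump_oracle y) x e.

Lemma halts_byP n : (exists s, halts_by s n) <-> jump set0 n.
Proof.
apply: accepts_jump; split=> // k m; rewrite /halt_oracle /=.
split=> [[_ /eqP ->]|[[[]]|[_ ->]]]; last by exists 0.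
by right; split=> // -[].
Qed.

(** A table is correct for the oracle 0' if no y refutes one of its answers. *)
Lemma halts2_byP e : jump (jump set0) e <-> exists x, forall y, halts2_by e x y.
Proof.
(* The limit of [jump_oracle y] when y runs through all numbers. *)
pose O (B n m : nat) :=
  if m == 0 then `[< ~ jump set0 n >] else (m == 1) && has (fun s => halts_by s n) (iota 0 B).
have OA : oracle_spec (jump set0) O.
  split=> [B B' n m BB'|n m]; rewrite /O.
    case: ifP => // _ /andP[-> /hasP[s]]; rewrite mem_iota add0n /= => sB ns.
    by apply/hasP; exists s => //; rewrite mem_iota add0n /= (leq_trans sB).
  case: eqVneq => [->|m0] /=.
    split=> [[_ /asboolP ?]|[[_ //]|[/asboolP ? _]]]; first by right.
    by exists 0.
  split=> [[B /andP[/eqP -> /hasP[s _ sn]]]|[[/halts_byP[s sn] ->]|[_ mE]]];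
    last by rewrite mE in m0.
    by left; split=> //; apply/halts_byP; exists s.
  by exists s.+1; exact: (has_iota_S (p := halts_by^~ n)).
suff clO x : closed O x <-> forall y, closed (jump_oracle y) x.
  rewrite -(accepts_jump _ OA); split=> -[x].
    by move=> /andP[/clO clx ex]; exists x => y; rewrite /halts2_by /accepts clx.
  move=> H; exists x; move: (H 0) => /andP[_ ex]; rewrite /accepts ex andbT.
  by apply/clO => y; case/andP: (H y).
have jE z : justified O (in_table x) x z <-> forall y, justified (jump_oracle y) (in_table x) x z.
  rewrite /justified /eval_rule; case: (nfst z) => [|?] /=; last by split=> // /(_ 0).
  case: (nfst (nfst (nsnd z))) => [|[|[|[|[|k]]]]] /=; try by split=> // /(_ 0).
  rewrite /O /jump_oracle; case: ifP => // _; last by split=> // /(_ 0).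
  split=> [/andP[-> /asboolP Kn] y|H].
    by apply/negP => yn; apply: Kn; apply/halts_byP; exists y.
  have /andP[-> _] := H 0; apply/asboolP => /halts_byP[y yn].
  by have := H y; rewrite yn andbF.
split=> [/closedP cl y|H]; first by apply/closedP => z /cl /jE.
by apply/closedP => z zx; apply/jE => y; have /closedP/(_ z zx) := H y.
Qed.

Lemma recf_entry A i t : recf A i -> recf A t -> recf A (fun n => entry (i n) (t n)).
Proof. by move=> ri rt; apply: recf_fst; apply: recf_iteri => //; rec_solve. Qed.

Lemma recp_in_table A T x :
  recf A T -> recf A x -> recp A (fun n => in_table (T n) (x n)).
Proof. by move=> rT rx; rewrite /in_table; do ?[rec_step | apply: recf_entry]. Qed.

Lemma recp_accepts A O y T e :
  (forall y B n m, recf A y -> recf A B -> recf A n -> recf A m ->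
    recp A (fun q => O (y q) (B q) (n q) (m q))) ->
  recf A y -> recf A T -> recf A e -> recp A (fun q => accepts (O (y q)) (T q) (e q)).
Proof.
move=> rO ry rT re; rewrite /accepts /closed /justified /eval_rule /code_rule.
rewrite /eval_claim /code_claim.
by cbv zeta; do ?[rec_step | apply: recf_entry | apply: recp_in_table | apply: rO].
Qed.

Lemma recp_halts_by A s n : recf A s -> recf A n -> recp A (fun q => halts_by (s q) (n q)).
Proof.
move=> rs rn; apply: (recp_accepts (O := fun=> halt_oracle) (y := fun=> 0)) => //.
  by move=> y B k m _ _ _ rm; rewrite /halt_oracle; rec_solve.
exact: recf_const.
Qed.

Lemma recp_halts2_by A e x y : recf A e -> recf A x -> recf A y ->
  recp A (fun q => halts2_by (e q) (x q) (y q)).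
Proof.
move=> re rx ry; apply: recp_accepts => // z B k m rz rB rk rm.
by rewrite /jump_oracle; do ?[rec_step | apply: recp_halts_by].
Qed.

(** * Cofiniteness along an infinite set *)

Lemma finite_natP (A : set nat) : finite_set A <-> exists k, forall n, A n -> n < k.
Proof.
split=> [/finite_seqP[s ->]|[k Ak]]; last exact: sub_finite_set (finite_II k).
exists (\max_(x <- (s : seq nat)) x).+1 => n /= ns; rewrite ltnS.
exact: (leq_bigmax_seq (F := id) n ns).
Qed.

Lemma almost_subP (C S : set nat) :
  almost_sub C S <-> exists k, forall n, k <= n -> C n -> S n.
Proof.
split=> [/finite_natP[k Ck]|[k Ck]].
  exists k => n kn Cn; apply: contrapT => nS.
  by have := Ck n (conj Cn nS); rewrite ltnNge kn.
by apply/finite_natP; exists k => n [Cn nS]; rewrite ltnNge; apply/negP => /Ck /(_ Cn).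
Qed.

Lemma almost_sub_frequent (C S : set nat) k : infinite_set C -> almost_sub C S ->
  exists n, [/\ k <= n, C n & S n].
Proof.
move=> infC /almost_subP[k' Ck']; apply: contrapT => none; apply/infC/finite_natP.
exists (maxn k k') => n Cn; rewrite ltnNge geq_max; apply/negP => /andP[kn k'n].
by apply: none; exists n; split=> //; exact: Ck'.
Qed.

Lemma almost_sub_all (C S : set nat) : (forall n, S n) -> almost_sub C S.
Proof. by move=> allS; apply/almost_subP; exists 0. Qed.

(** * The graph *)

Definition sample (m : nat) : nat := npair 0 m.
Definition link (i : nat) : nat := npair 1 i.
Definition witness (m i t : nat) : nat := npair 2 (npair m (npair i t)).
Definition hub : nat := npair 3 0.

(** For i = npair e j, evidence that m lies in the i-th set: if j = 0 this
    is the set that is cofinite when e is not in 0'', if j = x + 1 the set that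
    is cofinite when x witnesses e in 0''. The number t bounds the refutations y
    in the first case, which makes the enumeration of the set decidable. *)
Definition evidence (m i t : nat) : bool :=
  let e := nfst i in
  if nsnd i == 0 then all (fun x => has (fun y => ~~ halts2_by e x y) (iota 0 t)) (iota 0 m)
  else all (halts2_by e (nsnd i).-1) (iota 0 m).

Definition arc (x y : nat) : bool :=
  let m := nfst (nsnd x) in
  let i := nfst (nsnd (nsnd x)) in
  let t := nsnd (nsnd (nsnd x)) in
  [|| (nfst x == 1) && (y == link (nsnd x).+1),
      (x == hub) && (nfst y == 1)
    | [&& nfst x == 2, evidence m i t & (y == sample m) || (y == link i)]].

Definition adj (x y : nat) : bool := arc x y || arc y x.

Definition graph_of (r : nat -> nat -> bool) : structure nat :=
  @Structure nat setT (fun x y => r x y) (fun _ _ _ => conj I I).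

Definition sampling_graph : structure nat := graph_of adj.

Lemma recp_evidence A m i t :
  recf A m -> recf A i -> recf A t -> recp A (fun n => evidence (m n) (i n) (t n)).
Proof.
move=> rm ri rt; rewrite /evidence; cbv zeta.
by do ?[rec_step | apply: recp_halts2_by].
Qed.

Lemma recp_adj A x y : recf A x -> recf A y -> recp A (fun n => adj (x n) (y n)).
Proof.
suff arcR u v : recf A u -> recf A v -> recp A (fun n => arc (u n) (v n)).
  by move=> rx ry; apply: recp_or; exact: arcR.
move=> ru rv; rewrite /arc /hub /sample /link; cbv zeta.
by do ?[rec_step | apply: recp_evidence].
Qed.

Lemma arcP x y : reflect
  [\/ exists i, x = link i /\ y = link i.+1,
      exists i, x = hub /\ y = link i
    | exists m i t, [/\ x = witness m i t, evidence m i t & y = sample m \/ y = link i]]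
  (arc x y).
Proof.
apply: (iffP or3P) => -[].
- move=> /andP[/eqP x1 /eqP ->]; apply: Or31; exists (nsnd x).
  by rewrite /link -x1 npairK.
- move=> /andP[/eqP -> /eqP y1]; apply: Or32; exists (nsnd y).
  by rewrite /link -y1 npairK.
- move=> /and3P[/eqP x2 ev yE]; apply: Or33.
  exists (nfst (nsnd x)), (nfst (nsnd (nsnd x))), (nsnd (nsnd (nsnd x))).
  split=> //; first by rewrite /witness -x2 !npairK.
  by case/orP: yE => /eqP ->; [left | right].
- by move=> [i [-> ->]]; apply: Or31; rewrite /link !npE !eqxx.
- by move=> [i [-> ->]]; apply: Or32; rewrite /link !npE !eqxx.
- move=> [m [i [t [-> ev yE]]]]; apply: Or33; rewrite /witness !npE ev eqxx /=.
  by case: yE => ->; rewrite eqxx ?orbT.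
Qed.

(** A sample is joined to witnesses only, so a neighbour that it shares with a
    link carries evidence. *)
Lemma adj_common x m i : adj x (sample m) -> adj x (link i) -> exists t, evidence m i t.
Proof.
move=> /orP[] /arcP[].
- by move=> [j [_ /npair_inj[]]].
- by move=> [j [_ /npair_inj[]]].
- move=> [m' [i' [t [-> ev [/npair_inj[_ ->]|/npair_inj[]//]]]]] /orP[] /arcP[].
  + by move=> [j [/npair_inj[]]].
  + by move=> [j [/npair_inj[]]].
  + move=> [m2 [i2 [t2 [/npair_inj[_ /npair_inj[<- /npair_inj[<- <-]]] _]]]].
    by move=> [/npair_inj[]//|/npair_inj[_ ->]]; exists t.
  + by move=> [j [_ /npair_inj[]]].
  + by move=> [j [/npair_inj[]]].
  + by move=> [m2 [i2 [t2 [/npair_inj[]]]]].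
- by move=> [j [/npair_inj[]]].
- by move=> [j [/npair_inj[]]].
- by move=> [m2 [i2 [t2 [/npair_inj[]]]]].
Qed.

Lemma adj_link x i : adj x hub -> adj x (link i) ->
  x = link i.+1 \/ exists2 j, i = j.+1 & x = link j.
Proof.
have xP : adj x hub -> exists j, x = link j.
  move=> /orP[] /arcP[].
  - by move=> [j [_ /npair_inj[]]].
  - by move=> [j [_ /npair_inj[]]].
  - by move=> [m2 [i2 [t2 [_ _ [/npair_inj[]|/npair_inj[]]]]]].
  - by move=> [j [/npair_inj[]]].
  - by move=> [j [_ ->]]; exists j.
  - by move=> [m2 [i2 [t2 [/npair_inj[]]]]].
move=> /xP[j ->] /orP[] /arcP[].
- by move=> [k [/npair_inj[_ ->] /npair_inj[_ ->]]]; right; exists k.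
- by move=> [k [/npair_inj[]]].
- by move=> [m2 [i2 [t2 [/npair_inj[]]]]].
- by move=> [k [/npair_inj[_ ->] /npair_inj[_ ->]]]; left.
- by move=> [k [/npair_inj[]]].
- by move=> [m2 [i2 [t2 [/npair_inj[]]]]].
Qed.

Lemma sampling_graph_is_graph : is_graph sampling_graph.
Proof.
split=> [x y /=|x /=]; first by rewrite /adj orbC.
rewrite /adj orbb => /arcP[].
- by move=> [i [-> /npair_inj[_ /n_Sn]]].
- by move=> [i [-> /npair_inj[]]].
- by move=> [m [i [t [-> _ [/npair_inj[]|/npair_inj[]]]]]].
Qed.

Lemma turing_leP A B : turing_le A B <-> recp B (fun n => `[< A n >]).
Proof.
split=> -[c cP]; exists c => n.
  by case: asboolP => An; have [] := cP n; [move=> /(_ An) | move=> _ /(_ An)].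
by split=> An; have := cP n; case: asboolP.
Qed.

Lemma turing_le_diagram A (S : structure nat) :
  recp A (fun n => `[< dom S n >]) -> recp A (fun q => `[< edge S (nfst q) (nsnd q) >]) ->
  turing_le (diagram S) A.
Proof.
move=> rd re; apply/turing_leP.
have rh : recf A half by apply/recf_half/recf_id.
have ro : recp A odd by apply/recp_odd/recf_id.
apply: recp_eq (recp_if ro (recp_comp re rh) (recp_comp rd rh)) => n.
by rewrite /diagram /join /=; case: (odd n).
Qed.

Lemma diagram_edge S f g : recf (diagram S) f -> recf (diagram S) g ->
  recp (diagram S) (fun n => `[< edge S (f n) (g n) >]).
Proof.
move=> rf rg; have rd : recf (diagram S) (fun n => (npair (f n) (g n)).*2.+1).
  have rI : recf (diagram S) (fun n => (iteri (npair (f n) (g n)) (fun _ r => r.+2) 0).+1).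
    by apply: recf_succ; apply: recf_iteri; rec_solve.
  by apply: recf_eq rI => n; congr _.+1; elim: (npair _ _) => //= k ->; rewrite doubleS.
apply: recp_eq (recp_comp (recp_oracle _) rd) => n.
by rewrite /diagram /join /= odd_double uphalf_double !npE.
Qed.

Lemma sampling_graph_computable : computable_graph sampling_graph.
Proof.
split; [exact: sampling_graph_is_graph | by exists 0 |].
apply: turing_le_diagram => /=.
  by apply: recp_eq (recp_const _ true) => n; rewrite asboolT.
apply: recp_eq (recp_adj (recf_fst (recf_id _)) (recf_snd (recf_id _))) => q.
by rewrite asboolb.
Qed.

(** * Partial computable functions and cohesive powers *)

Definition pfun_of (c : code) : pfun := fun n =>
  if pselect (exists m, eval set0 c n m) is left ex then Some (sval (cid ex)) else None.

Lemma pfun_ofP c n m : pfun_of c n = Some m <-> eval set0 c n m.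
Proof.
rewrite /pfun_of; case: pselect => [ex|nex]; last by split=> // cm; case: nex; exists m.
case: (cid ex) => k ck /=; split=> [[<-] //|cm].
by rewrite (eval_det ck cm).
Qed.

Lemma pfun_of_computable c : partial_computable (pfun_of c).
Proof. by exists c => n m; exact: pfun_ofP. Qed.

Lemma partial_computableP f : partial_computable f -> exists c, f = pfun_of c.
Proof.
move=> [c fc]; exists c; apply/funext => n.
case fn: (f n) => [m|]; first by apply/esym/pfun_ofP/fc.
case cn: (pfun_of c n) => [m|] //.
by move/pfun_ofP/fc: cn; rewrite fn.
Qed.

Lemma pdom_pfun_of c : pdom (pfun_of c) = [set n | exists m, eval set0 c n m].
Proof.
apply/seteqP; split=> n /=; rewrite /pdom /=.
  by case cn: (pfun_of c n) => [m|] // _; exists m; apply/pfun_ofP.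
by move=> [m /pfun_ofP ->].
Qed.

Lemma ce_semirec P : semirec set0 P -> ce [set n | P n].
Proof.
move=> [c cP]; exists (pfun_of c); first exact: pfun_of_computable.
by rewrite pdom_pfun_of; apply/seteqP; split=> n /=; apply cP.
Qed.

(** A program that halts on [n] exactly when the values of [f] and [g] at [n]
    are related, given a test [d] that returns 0 on related pairs. *)
Definition test_code (d f g : code) : code := Mu (Comp d (Pair (Comp f Fst) (Comp g Fst))).

Lemma eval_test_code (D : nat -> nat -> bool) d f g n :
  (forall q, eval set0 d q (~~ D (nfst q) (nsnd q))) ->
  (exists m, eval set0 (test_code d f g) n m) <->
  exists x y, [/\ pfun_of f n = Some x, pfun_of g n = Some y & D x y].
Proof.
move=> dD; split=> [[m [[q [x [y [[a /= ->]]]]]]]|[x [y [/pfun_ofP fx /pfun_ofP gy Dxy]]]].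
  rewrite npE => fx [b /= ->] gy -> dq _; exists x, y.
  split; [exact/pfun_ofP | exact/pfun_ofP |].
  by have := eval_det (dD _) dq; rewrite !npE; case: (D x y).
exists 0; split=> //; exists (npair x y).
  exists x, y; split=> //.
    by exists n => //=; rewrite npE.
  by exists n => //=; rewrite npE.
by move: (dD (npair x y)); rewrite !npE Dxy.
Qed.

(** Cohesiveness decides every decidable relation between two elements of the
    power. *)
Lemma cohesive_test C (D : nat -> nat -> bool) f g : cohesive C ->
  recp set0 (fun q => D (nfst q) (nsnd q)) -> partial_computable f -> partial_computable g ->
  let W := [set n | exists x y, [/\ f n = Some x, g n = Some y & D x y]] in
  almost_sub C W \/ almost_sub C (~` W).
Proof.
move=> [_ cohC] /recp_neg[d dD] /partial_computableP[c ->] /partial_computableP[c' ->] /=.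
apply: cohC; apply: ce_semirec; exists (test_code d c c') => n.
exact: iff_sym (eval_test_code _ _ _ dD).
Qed.

Definition total (f : nat -> nat) : pfun := fun n => Some (f n).

Lemma total_computable f : recf set0 f -> partial_computable (total f).
Proof.
move=> [c cf]; exists c => n m; split=> [[<-] //|cm].
by rewrite /total (eval_det cm (cf n)).
Qed.

Lemma cp_fun_total r C f : recf set0 f -> cp_fun (graph_of r) C (total f).
Proof. by move=> rf; split=> //; [exact: total_computable | exact: almost_sub_all]. Qed.

(** * Every copy of the power computes the double jump *)

Lemma cp_copy G C P (F : nat -> set pfun) x y f g :
  (forall x y, dom P x -> dom P y -> edge P x y <-> edge (cohesive_power G C) (F x) (F y)) ->
  dom P x -> dom P y -> cp_fun G C f -> cp_fun G C g ->
  F x = cp_class G C f -> F y = cp_class G C g -> edge P x y <-> edgeC G C f g.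
Proof. by move=> FP Px Py Cf Cg Fx Fy; rewrite FP // Fx Fy; exact: cp_edgeP. Qed.

Lemma edgeC_total (r : nat -> nat -> bool) C f g :
  (forall n, r (f n) (g n)) -> edgeC (graph_of r) C (total f) (total g).
Proof. by move=> rfg; apply: almost_sub_all => n; exists (f n), (g n); split=> //; exact: rfg. Qed.

Lemma eqC_const C a b : infinite_set C ->
  eqC C (total (fun=> a)) (total (fun=> b)) -> a = b.
Proof. by move=> infC /(almost_sub_frequent 0 infC)[n [_ _ [x [[->] [->]]]]]. Qed.

(** What a copy with edge relation E can check: t lists vertices that start
    with c and run along the path of links up to position i, where h stands for
    the hub, and w is a common neighbour of a and of the last of them. A
    vertex of the list differs from the one two places before it, which
    excludes turning back; at the first step this only compares neighbours,
    since 0.-1 = 0. *)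
Definition finds (E : nat -> nat -> bool) (a h c i w t : nat) : bool :=
  [&& entry 0 t == c,
      all (fun k => [&& E (entry k.+1 t) (entry k t), E (entry k.+1 t) h
                      & entry k.+1 t != entry k.-1 t]) (iota 0 i),
      E w a & E w (entry i t)].

(** Evidence at infinitely many m covers all x, or all y, since the ranges of
    the bounded quantifiers in [evidence] grow with m. *)
Lemma evidence_persistent C e j : infinite_set C ->
  almost_sub C [set m | exists t, evidence m (npair e j) t] ->
  jump (jump set0) e <-> j != 0.
Proof.
move=> infC evC; have ev k : exists m t, k <= m /\ evidence m (npair e j) t.
  by have [m [km _ [t ev]]] := almost_sub_frequent k infC evC; exists m, t.
rewrite halts2_byP; case: j {evC} ev => [|j] ev; split=> //.
  move=> [x xP]; have [m [t [xm]]] := ev x.+1; rewrite /evidence !npE /=.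
  move=> /allP/(_ x); rewrite mem_iota add0n => /(_ xm)/hasP[y _].
  by rewrite xP.
move=> _; exists j => y; have [m [t [ym]]] := ev y.+1; rewrite /evidence !npE /=.
by move=> /allP/(_ y); rewrite mem_iota add0n; apply.
Qed.

Lemma evidence_exists e : exists j f, recf set0 f /\ forall m, evidence m (npair e j) (f m).
Proof.
case: (pselect (jump (jump set0) e)) => [/halts2_byP[x xP]|He].
  exists x.+1, (fun=> 0); split=> [|m]; first exact: recf_const.
  by rewrite /evidence !npE /=; apply/allP => y _; exact: xP.
have noloss x : exists y, ~~ halts2_by e x y.
  apply: contrapT => nex; apply/He/halts2_byP; exists x => y.
  by apply: contrapT => /negP ?; apply: nex; exists y.
exists 0; have [|m|f rf fP] := @recf_mu set0 (fun m t => evidence m (npair e 0) t).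
- by apply: recp_evidence; rec_solve.
- rewrite /evidence !npE /=; elim: m => [|m [t tP]]; first by exists 0.
  have [y ym] := noloss m; exists (maxn t y.+1).
  rewrite -(addn1 m) iotaD all_cat /= andbT add0n; apply/andP; split.
    apply/allP => x /(allP tP)/hasP[z]; rewrite mem_iota /= add0n => zt xz.
    by apply/hasP; exists z => //; rewrite mem_iota /= add0n leq_max zt.
  by apply/hasP; exists y => //; rewrite mem_iota /= add0n leq_max ltnSn orbT.
- by exists f.
Qed.

Lemma recf_sample A f : recf A f -> recf A (fun n => sample (f n)).
Proof. by move=> rf; rewrite /sample; rec_solve. Qed.

(** The copy is searched for a list of links and a common neighbour of the
    last of them with the vertex a that stands for the class of [sample]. The
    vertices a, h and c 0 are the finitely many parameters of this search. *)
Theorem copy_computes_double_jump C P : cohesive C ->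
  presentation (cohesive_power sampling_graph C) P -> turing_le (jump (jump set0)) (diagram P).
Proof.
move=> cohC [_ [F [[Fdom Finj Fsurj] FE]]]; have infC := cohC.1.
have edgeE := cp_copy FE.
have preim f : recf set0 f -> exists2 x, dom P x & F x = cp_class sampling_graph C (total f).
  move=> rf; have Cf : cp_fun sampling_graph C (total f) by exact: cp_fun_total.
  have /Fsurj[x Px Fx] : dom (cohesive_power sampling_graph C)
      (cp_class sampling_graph C (total f)).
    by exists (total f).
  by exists x.
have rep x : dom P x -> exists2 f, cp_fun sampling_graph C f & F x = cp_class sampling_graph C f.
  by move=> /Fdom[f Cf <-]; exists f.
have r_sample : recf set0 sample by apply: recf_sample; exact: recf_id.
have [a Pa Fa] := preim _ r_sample.
have [h Ph Fh] := preim _ (recf_const _ hub).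
have [c Pc Fc] : exists2 c, forall i, dom P (c i) &
    forall i, F (c i) = cp_class sampling_graph C (total (fun=> link i)).
  have /boolp.choice[c cP] : forall i, exists x, dom P x /\
      F x = cp_class sampling_graph C (total (fun=> link i)).
    by move=> i; have [x Px Fx] := preim _ (recf_const _ (link i)); exists x.
  by exists c => i; have [] := cP i.
have Cl i : cp_fun sampling_graph C (total (fun=> link i)).
  by apply: cp_fun_total; exact: recf_const.
have Ch : cp_fun sampling_graph C (total (fun=> hub)).
  by apply: cp_fun_total; exact: recf_const.
have Cs : cp_fun sampling_graph C (total sample) by exact: cp_fun_total.
pose E x y := `[< edge P x y >].
have c_inj i j : c i = c j -> i = j.
  move=> cij; have /(cp_classP (Cl i) (Cl j)) : cp_class sampling_graph C (total (fun=> link i)) =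
    cp_class sampling_graph C (total (fun=> link j)) by rewrite -!Fc cij.
  by move/(eqC_const infC)/npair_inj => [].
(* Both neighbours on the path are possible values of a function representing
   x; cohesiveness chooses one of them for almost all arguments in C. *)
have c_step x i : E x (c i) -> E x h -> x != c i.-1 -> x = c i.+1.
  move=> /asboolP xi /asboolP xh /eqP xi1; have [Px _] := edge_dom xi.
  have [f Cf Fx] := rep x Px.
  have {}xi := (edgeE _ _ _ _ Px (Pc i) Cf (Cl i) Fx (Fc i)).1 xi.
  have {}xh := (edgeE _ _ _ _ Px Ph Cf Ch Fx Fh).1 xh.
  have links : almost_sub C [set n | f n = Some (link i.+1) \/
      exists2 j, i = j.+1 & f n = Some (link j)].
    apply: almost_subS (almost_subI xi xh) => n [[u [_ [fu [<-] ui]]] [v [_ [fv [<-] vh]]]].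
    have uv : v = u by move: fv; rewrite fu => -[].
    rewrite uv in vh.
    have [uE|[j -> uE]] := adj_link vh ui; first by left; rewrite fu uE.
    by right; exists j; rewrite ?fu ?uE.
  have same_class j : almost_sub C [set n | f n = Some (link j)] -> x = c j.
    move=> fj; apply: Finj; rewrite ?inE //.
    rewrite Fx Fc; apply/(cp_classP Cf (Cl j)); apply: almost_subS fj => n fn.
    by exists (link j).
  have rD : recp set0 (fun q => nfst q == nsnd q) by rec_solve.
  have [fCf _ _] := Cf; have [fCl _ _] := Cl i.+1.
  have [up|down] := cohesive_test cohC rD fCf fCl.
    by apply: same_class; apply: almost_subS up => n [u [v [fu [<-] /eqP uv]]]; rewrite -uv.
  case: i {xi fCl} xi1 links down => [|i] xi1 links down.
    apply: same_class; apply: almost_subS links => n [//|[j //]].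
  case: xi1; apply: same_class.
  apply: almost_subS (almost_subI links down) => n [[fn|[j [<-] //]] []].
  by exists (link i.+2), (link i.+2).
have chain t i : entry 0 t = c 0 ->
    all (fun k => [&& E (entry k.+1 t) (entry k t), E (entry k.+1 t) h
                      & entry k.+1 t != entry k.-1 t]) (iota 0 i) ->
    forall k, k <= i -> entry k t = c k.
  move=> t0 tS; elim/ltn_ind => -[|k] IHk ki //.
  have /(allP tS)/and3P[] : k \in iota 0 i by rewrite mem_iota.
  have k1 : k.-1 < k.+1 by rewrite ltnS leq_pred.
  by rewrite (IHk k) ?(IHk k.-1) ?(ltnW ki) ?(leq_trans (leq_pred k)) ?(ltnW ki) //; exact: c_step.
have found e : exists u, finds E a h (c 0) (npair e (nfst u)) (nfst (nsnd u)) (nsnd (nsnd u)).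
  have [j [f [rf fP]]] := evidence_exists e.
  pose i := npair e j.
  have rw : recf set0 (fun m => witness m i (f m)) by rewrite /witness; rec_solve.
  have [w Pw Fw] := preim _ rw; have Cw := cp_fun_total adj C rw.
  exists (npair j (npair w (foldr npair 0 (map c (iota 0 i.+1))))); rewrite !npE /finds -/i.
  have entE k : k <= i -> entry k (foldr npair 0 (map c (iota 0 i.+1))) = c k.
    by move=> ki; rewrite entry_table ?(nth_map 0) ?size_map ?size_iota // nth_iota.
  rewrite !entE // eqxx; apply/and4P; split=> //.
  - apply/allP => k; rewrite mem_iota add0n => /= ki.
    rewrite !entE ?(leq_trans (leq_pred _)) ?(ltnW ki) //; apply/and3P; split.
    + apply/asboolP/(edgeE _ _ _ _ (Pc _) (Pc _) (Cl _) (Cl _) (Fc _) (Fc _)).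
      apply: edgeC_total => _; apply/orP; right; apply/arcP; apply: Or31.
      by exists k.
    + apply/asboolP/(edgeE _ _ _ _ (Pc _) Ph (Cl _) Ch (Fc _) Fh).
      apply: edgeC_total => _; apply/orP; right; apply/arcP; apply: Or32.
      by exists k.+1.
    + by apply/eqP => /c_inj; case: k {ki} => //= k /esym /eqP; rewrite ltn_eqF.
  - apply/asboolP/(edgeE _ _ _ _ Pw Pa Cw Cs Fw Fa).
    apply: edgeC_total => m; apply/orP; left; apply/arcP; apply: Or33.
    by exists m, i, (f m); split=> //; left.
  - apply/asboolP/(edgeE _ _ _ _ Pw (Pc _) Cw (Cl _) Fw (Fc _)).
    apply: edgeC_total => m; apply/orP; left; apply/arcP; apply: Or33.
    by exists m, i, (f m); split=> //; right.
have finds_correct e j w t : finds E a h (c 0) (npair e j) w t ->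
    jump (jump set0) e <-> j != 0.
  move=> /and4P[/eqP t0 tS wa]; rewrite (chain _ _ t0 tS) // => wi.
  move: wa wi => /asboolP wa /asboolP wi; have [Pw _] := edge_dom wa.
  have [f Cf Fw] := rep w Pw; apply: (evidence_persistent infC).
  apply: almost_subS (almost_subI ((edgeE _ _ _ _ Pw Pa Cf Cs Fw Fa).1 wa)
    ((edgeE _ _ _ _ Pw (Pc _) Cf (Cl _) Fw (Fc _)).1 wi)).
  move=> n [[u [_ [fu [<-] ua]]] [v [_ [fv [<-] vi]]]].
  by apply: (adj_common (x := u)) => //; move: fv; rewrite fu => -[->].
have rE f g : recf (diagram P) f -> recf (diagram P) g -> recp (diagram P) (fun n => E (f n) (g n)).
  exact: diagram_edge.
have rfinds : recp (diagram P) (fun q => finds E a h (c 0) (npair (nfst q) (nfst (nsnd q)))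
    (nfst (nsnd (nsnd q))) (nsnd (nsnd (nsnd q)))).
  by rewrite /finds; do ?[rec_step | apply: recf_entry | apply: rE].
have [g rg gP] := recf_mu (p := fun e u =>
  finds E a h (c 0) (npair e (nfst u)) (nfst (nsnd u)) (nsnd (nsnd u))) rfinds found.
apply/turing_leP; have rj : recp (diagram P) (fun e => nfst (g e) != 0) by rec_solve.
apply: recp_eq rj => e; apply/esym/asbool_equiv_eqP; first exact: idP.
exact: finds_correct (gP e).
Qed.

(** * The power has a copy computable in the double jump *)

Lemma semirec_iff A P Q : (forall n, P n <-> Q n) -> semirec A P -> semirec A Q.
Proof. by move=> PQ [c cP]; exists c => n; rewrite -PQ. Qed.

Lemma recp_setC A B : recp A (fun n => `[< (~` B) n >]) -> recp A (fun n => `[< B n >]).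
Proof.
move=> /recp_neg; apply: recp_eq => n; rewrite -asbool_neg.
by apply: asbool_equiv_eq; split=> [/contrapT|Bn nBn].
Qed.

Lemma Sigma1_semirec A : Sigma 1 A -> semirec set0 A.
Proof.
move=> [B /turing_leP/recp_setC rB ->].
have rB' : recp set0 (fun q => `[< B (npair (nfst q) (nsnd q)) >]).
  by apply: recp_eq rB => q; rewrite npairK.
apply: semirec_iff (semirec_ex (p := fun x y => `[< B (npair x y) >]) rB') => x /=.
by split=> -[y Bxy]; exists y; apply/asboolP.
Qed.

Lemma Sigma2_jump A : Sigma 2 A ->
  exists2 p, recp (jump set0) (fun q => p (nfst q) (nsnd q)) & forall x, A x <-> exists y, p x y.
Proof.
move=> [B /Sigma1_semirec/semirec_jump/recp_setC rB ->].
exists (fun x y => `[< B (npair x y) >]); first by apply: recp_eq rB => q; rewrite npairK.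
by move=> x; split=> -[y]; [move=> ?; exists y; apply/asboolP | move/asboolP; exists y].
Qed.

(** Both a set and its complement being enumerable from 0', membership is decided
    by a search. *)
Lemma Delta2_jump A : Delta 2 A -> recp (jump set0) (fun n => `[< A n >]).
Proof.
move=> [/Sigma2_jump[p rp Ap] /Sigma2_jump[q rq Aq]].
have [|f rf fP] := recf_mu (p := fun x y => p x y || q x y) (recp_or rp rq).
  move=> x; have [Ax|nAx] := pselect (A x).
    by have [y py] := (Ap x).1 Ax; exists y; rewrite py.
  by have [y qy] := (Aq x).1 nAx; exists y; rewrite qy orbT.
apply: recp_eq (recp_app2 rp (recf_id _) rf) => n.
apply/esym/asbool_equiv_eqP; first exact: idP.
rewrite Ap; split=> [An|]; last by exists (f n).
case/orP: (fP n) => // qn; have nAn : (~` A) n by apply/Aq; exists (f n).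
by case: nAn; apply/Ap.
Qed.

Definition mostly_halts (C : set nat) (e : nat) : Prop := almost_sub C (halts set0 e).

(** With a threshold k, both that the program halts on all elements of C from
    k on and that it halts on none of them are negations of statements
    enumerable from 0'. One of the two has a threshold because C is cohesive, and
    not both have one because C is infinite. *)
Lemma recp_mostly_halts C f : Delta 2 C -> cohesive C -> recf (jump (jump set0)) f ->
  recp (jump (jump set0)) (fun n => `[< mostly_halts C (f n) >]).
Proof.
move=> /Delta2_jump rC [infC cohC] rf.
have rH : recp (jump set0) (fun q => `[< halts set0 (nfst (nfst q)) (nsnd q) >]).
  by apply: recp_halts; rec_solve.
(* Both alternatives at once: b is the identity or the negation. *)
have bounded (b : bool -> bool) :
    recp (jump set0) (fun q => b `[< halts set0 (nfst (nfst q)) (nsnd q) >]) ->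
    recp (jump (jump set0)) (fun q =>
      `[< forall n, nsnd q <= n -> C n -> ~ b `[< halts set0 (nfst q) n >] >]).
  move=> rb; pose p q n := [&& nsnd q <= n, `[< C n >] & b `[< halts set0 (nfst q) n >]].
  have rp : recp (jump set0) (fun q => p (nfst q) (nsnd q)).
    rewrite /p; apply: recp_and; first by rec_solve.
    by apply: recp_and => //; apply: (recp_comp rC); rec_solve.
  apply: recp_eq (recp_neg (semirec_jump (semirec_ex rp))) => q.
  rewrite -asbool_neg; apply: asbool_equiv_eq; split.
    by move=> nex n qn Cn bn; apply: nex; exists n; rewrite /p qn bn andbT; apply/asboolP.
  by move=> H [n /and3P[qn /asboolP Cn bn]]; exact: (H n).
pose inside e k := `[< forall n, k <= n -> C n -> ~ ~~ `[< halts set0 e n >] >].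
pose outside e k := `[< forall n, k <= n -> C n -> ~ `[< halts set0 e n >] >].
have rin : recp (jump (jump set0)) (fun q => inside (nfst q) (nsnd q)) := bounded negb (recp_neg rH).
have rout : recp (jump (jump set0)) (fun q => outside (nfst q) (nsnd q)) := bounded id rH.
have [|g rg gP] := recf_mu (p := fun e k => inside e k || outside e k) (recp_or rin rout).
  move=> e; have : almost_sub C (halts set0 e) \/ almost_sub C (~` halts set0 e).
    have [[c cE]|nc] := pselect (exists c, godel c = e).
      apply: cohC; apply: (@ce_semirec (halts set0 e)); exists c => n.
      by split=> [[d []]|cn]; [rewrite -cE => /godel_inj -> | exists c].
    by right; apply: almost_sub_all => n [c [cE _]]; apply: nc; exists c.
  move=> [] /almost_subP[k Ck]; exists k; apply/orP; [left | right]; apply/asboolP => n kn Cn.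
    by apply/negP; rewrite negbK; apply/asboolP; exact: Ck.
  by move/asboolP; exact: Ck.
apply: recp_eq (recp_comp (recp_app2 rin (recf_id _) rg) rf) => n.
apply: asbool_equiv_eq; split=> [H|mC].
  apply/almost_subP; exists (g (f n)) => m gm Cm.
  by have /negP := H m gm Cm; rewrite negbK => /asboolP.
case/orP: (gP (f n)) => /asboolP // out.
have [m [gm Cm /asboolP hm]] := almost_sub_frequent (g (f n)) infC mC.
by case: (out m gm Cm).
Qed.

(** The Goedel number of [test_code], as a function of those of the two programs
    under comparison. *)
Definition test_index (d : code) (e e' : nat) : nat :=
  npair 8 (npair 6 (npair (godel d) (npair 5
    (npair (npair 6 (npair e (godel Fst))) (npair 6 (npair e' (godel Fst))))))).

Lemma godel_test_code d f g : godel (test_code d f g) = test_index d (godel f) (godel g).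
Proof. by []. Qed.

Lemma recf_test_index A d : recf A (fun q => test_index d (nfst q) (nsnd q)).
Proof. by rewrite /test_index; rec_solve. Qed.

Lemma halts_godel A c : halts A (godel c) = [set n | exists m, eval A c n m].
Proof.
apply/seteqP; split=> n /=; first by move=> [d [/godel_inj ->]].
by exists c.
Qed.

Lemma mostly_test C (D : nat -> nat -> bool) d f g :
  (forall q, eval set0 d q (~~ D (nfst q) (nsnd q))) ->
  mostly_halts C (test_index d (godel f) (godel g)) <->
  almost_sub C [set n | exists x y, [/\ pfun_of f n = Some x, pfun_of g n = Some y & D x y]].
Proof.
move=> dD; rewrite /mostly_halts -godel_test_code halts_godel.
by split; apply: almost_subS => n /=; rewrite (eval_test_code f g n dD).
Qed.

(** The domain of the copy consists of the least Goedel number in each class. *)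
Theorem cohesive_power_copy (r : nat -> nat -> bool) C :
  recp set0 (fun q => r (nfst q) (nsnd q)) -> Delta 2 C -> cohesive C ->
  exists2 P, presentation (cohesive_power (graph_of r) C) P &
             turing_le (diagram P) (jump (jump set0)).
Proof.
move=> /recp_neg[dr drP] DC cohC; set G := graph_of r.
have /recp_neg[de deP] : recp set0 (fun q => nfst q == nsnd q) by rec_solve.
pose same e e' := mostly_halts C (test_index de e e').
pose joined e e' := mostly_halts C (test_index dr e e').
pose least e := [set i | mostly_halts C i /\ same i e].
pose canon e := mostly_halts C e /\ forall i, i < e -> ~ least e i.
have edge_canon x y : [/\ canon x, canon y & joined x y] -> canon x /\ canon y by case.
pose P := Structure edge_canon.
have cp_pfun c : cp_fun G C (pfun_of c) <-> mostly_halts C (godel c).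
  rewrite /mostly_halts halts_godel -pdom_pfun_of.
  by split=> [[]//|dc]; split=> //; exact: pfun_of_computable.
have mostly_code e : mostly_halts C e -> exists c, e = godel c.
  by move=> /(almost_sub_frequent 0 cohC.1)[n [_ _ [c [<- _]]]]; exists c.
have sameE f g : same (godel f) (godel g) <-> eqC C (pfun_of f) (pfun_of g).
  rewrite /same (mostly_test C f g (D := eq_op) deP); split; apply: almost_subS => n.
    by move=> [x [y [fx gy /eqP xy]]]; exists x; rewrite fx gy xy.
  by move=> [x [fx gx]]; exists x, x.
have joinedE f g : joined (godel f) (godel g) <-> edgeC G C (pfun_of f) (pfun_of g).
  exact: mostly_test.
pose fn e : pfun := if pselect (exists c, e = godel c) is left ex then pfun_of (sval (cid ex))
  else fun=> None.
have fnE c : fn (godel c) = pfun_of c.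
  rewrite /fn; case: pselect => [ex|[]]; last by exists c.
  by case: (cid ex) => d /= /godel_inj ->.
have surj f : cp_fun G C f -> exists2 e, canon e & cp_class G C (fn e) = cp_class G C f.
  move=> Cf; have [/partial_computableP[c fE] _ _] := Cf.
  have exP : exists e, `[< least (godel c) e >].
    exists (godel c); apply/asboolP; rewrite fE in Cf; split; first exact/cp_pfun.
    exact/sameE/(eqC_refl Cf).
  case: (ex_minnP exP) => e /asboolP[me ec] emin; have [d eE] := mostly_code e me.
  rewrite eE in me ec emin *; have dc := (sameE _ _).1 ec.
  exists (godel d); last first.
    by rewrite fnE fE; apply/(cp_classP ((cp_pfun d).2 me)) => //; rewrite -fE.
  split=> // i lti [mi id]; have [k iE] := mostly_code i mi.
  have : least (godel c) i.
    by split=> //; rewrite iE; apply/sameE; apply: eqC_trans dc; apply/sameE; rewrite -iE.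
  by move=> /asboolP/emin; rewrite leqNgt lti.
exists P.
  split.
    have [|e ce _] := surj (total (fun=> 0)); last by exists e.
    by apply: cp_fun_total; exact: recf_const.
  exists (fun e => cp_class G C (fn e)); split.
    split.
    - move=> e [me _]; exists (fn e) => //; have [c eE] := mostly_code e me.
      by rewrite eE fnE; apply/cp_pfun; rewrite -eE.
    - move=> e e'; rewrite !inE => -[me ce] [me' ce'].
      have [[c eE] [c' eE']] := (mostly_code e me, mostly_code e' me').
      rewrite eE eE' !fnE in me me' ce ce' * => /cp_classP.
      move=> /(_ ((cp_pfun c).2 me) ((cp_pfun c').2 me')) cc'.
      case: (ltngtP (godel c) (godel c')) => // lt.
        by case: (ce' _ lt); split=> //; exact/sameE.
      by case: (ce _ lt); split=> //; exact/sameE/eqC_sym.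
    - by move=> K [f Cf <-]; have [e ce fe] := surj f Cf; exists e.
  move=> e e' [me ce] [me' ce'].
  have [[c eE] [c' eE']] := (mostly_code e me, mostly_code e' me').
  rewrite eE eE' !fnE in me me' ce ce' *.
  rewrite (cp_edgeP ((cp_pfun c).2 me) ((cp_pfun c').2 me')) -joinedE.
  by split=> [[]|].
have rM f : recf (jump (jump set0)) f ->
  recp (jump (jump set0)) (fun n => `[< mostly_halts C (f n) >]) by exact: recp_mostly_halts.
have rT d f g : recf (jump (jump set0)) f -> recf (jump (jump set0)) g ->
    recp (jump (jump set0)) (fun n => `[< mostly_halts C (test_index d (f n) (g n)) >]).
  by move=> rf rg; apply: rM; apply: recf_app2 rf rg; exact: recf_test_index.
have rcanon f : recf (jump (jump set0)) f ->
    recp (jump (jump set0)) (fun n => `[< canon (f n) >]).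
  move=> rf; have rI : recp (jump (jump set0)) (fun n => `[< mostly_halts C (f n) >] &&
      all (fun i => ~~ (`[< mostly_halts C i >] && `[< same i (f n) >])) (iota 0 (f n))).
    by do ?[rec_step | apply: rT | apply: rM].
  apply: recp_eq rI => n.
  apply/esym/asbool_equiv_eqP; first exact: andP.
  split=> [[mf H]|[/asboolP mf /allP H]].
    split; first exact/asboolP.
    apply/allP => i; rewrite mem_iota add0n => /= /H nl.
    by rewrite -asbool_and -asbool_neg; apply/asboolP.
  split=> [//|i lti [mi si]]; have : i \in iota 0 (f n) by rewrite mem_iota.
  by move=> /H; rewrite -asbool_and => /negP; apply; apply/asboolP.
apply: turing_le_diagram => /=; first exact/rcanon/recf_id.
apply: recp_eq (recp_and (rcanon _ (recf_fst (recf_id _))) (recp_and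
  (rcanon _ (recf_snd (recf_id _))) (rT dr _ _ (recf_fst (recf_id _)) (recf_snd (recf_id _))))) => q.
rewrite -!asbool_and; apply: asbool_equiv_eq; split; first by move=> [? []].
by move=> [].
Qed.

Theorem corollary3p4 :
  exists G : structure nat, computable_graph G /\
    forall C : set nat, Delta 2 C -> cohesive C ->
      has_degree (cohesive_power G C) (jump (jump set0)).
Proof.
exists sampling_graph; split; first exact: sampling_graph_computable.
move=> C DC cohC; split; last by move=> P; exact: copy_computes_double_jump.
by apply: cohesive_power_copy => //; apply: recp_adj; rec_solve.
Qed.
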